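(* Suppose that $T:\ell_\infty/c_0\rightarrow\ell_\infty/c_0$ is an automorphism. Then the following are equivalent: (1) there are infinite $A,B\subseteq\mathbb{N}$ such that $T_{B,A}$ is an isomorphism and is liftable; (2) there are infinite $A,B\subseteq\mathbb{N}$ such that $T_{B,A}$ is an isomorphism and is a matrix operator; (3) there are infinite $A,B\subseteq\mathbb{N}$ such that $T_{B,A}$ is an isomorphism and has a lifting $S$ whose restriction to the closed unit ball is continuous with respect to the product topologies; (4) there are infinite $A,B\subseteq\mathbb{N}$ such that $T_{B,A}$ is trivial.
   Context: All operators are bounded and linear between real Banach spaces; isomorphism means linear homeomorphism onto; an automorphism is an isomorphism of a space onto itself. For infinite $A\subseteq\mathbb{N}$, $\ell_\infty(A)$ and $c_0(A)$ are the bounded, respectively null, real functions on $A$, and $[f]$ denotes the class of $f\in\ell_\infty(A)$ modulo $c_0(A)$. For infinite $A,B\subseteq\mathbb{N}$ put $P_B([f])=[f|B]$ for $f\in\ell_\infty$, and $I_A([g])=[g\cup 0_{\mathbb{N}\setminus A}]$ for $g\in\ell_\infty(A)$ (extension by zero). The localization of $T$ to $(A,B)$ is $T_{B,A}=P_B\circ T\circ I_A:\ell_\infty(A)/c_0(A)\rightarrow\ell_\infty(B)/c_0(B)$. Let $V:\ell_\infty(A)/c_0(A)\rightarrow\ell_\infty(B)/c_0(B)$ be an operator. If $A'\subseteq A$ is cofinite in $A$, then $\ell_\infty(A')/c_0(A')$ is canonically identified with $\ell_\infty(A)/c_0(A)$ (and similarly for $B$). With these identifications: - $V$ is liftable if there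 are cofinite $A'\subseteq A$, $B'\subseteq B$ and an operator $S:\ell_\infty(A')\rightarrow\ell_\infty(B')$ (a lifting of $V$) with $V([f])=[S(f)]$ for all $f\in\ell_\infty(A')$. - $V$ is a matrix operator if there are cofinite $A'\subseteq A$, $B'\subseteq B$ and a real matrix $(b_{ij})_{i\in B',j\in A'}$ defining a bounded operator $c_0(A')\rightarrow c_0(B')$ such that $V([f])=[(\sum_{j\in A'}b_{ij}f(j))_{i\in B'}]$ for all $f\in\ell_\infty(A')$. - $V$ is trivial if there are cofinite $A'\subseteq A$, $B'\subseteq B$, a bijection $\sigma:B'\rightarrow A'$ and a nonzero $r\in\mathbb{R}$ such that $V([f])=[r f\circ\sigma]$ for all $f\in\ell_\infty(A')$. The product topology on $\ell_\infty(A')$ is the one inherited from $\mathbb{R}^{A'}$. *)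

(* Defs.v *)
From HB Require Import structures.
From mathcomp Require Import all_boot all_order all_algebra.
From mathcomp Require Import all_classical all_reals all_analysis.

Set Implicit Arguments.
Unset Strict Implicit.
Unset Printing Implicit Defensive.

Import Order.TTheory GRing.Theory Num.Theory.
Import numFieldNormedType.Exports.

Local Open Scope classical_set_scope.
Local Open Scope ring_scope.
Local Open Scope quotient_scope.

Lemma ext0E (R : realType) (A : set nat) (f : A -> R) n :
  'valL_0 f n = oapp f 0 (insub n).
Proof. by rewrite /valL_ /= oinv_set_val. Qed.

Section linf.
Context (R : realType) (A : set nat).

Definition bounded_pred : {pred (A -> R)} := fun f => f \in bounded_fun.

Lemma bounded_predP (f : A -> R) :
  reflect (exists M, forall x, `|f x| <= M) (f \in bounded_pred).
Proof.
apply: (iffP idP) => [/set_mem [M [_ hM]]|[M hM]].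
  by exists (M + 1) => x; apply: hM => //; rewrite ltrDl.
apply/mem_set; exists M; split; first exact: num_real.
by move=> N MN x _; apply: le_trans (hM x) (ltW MN).
Qed.

Lemma bounded_pred_submod : GRing.submod_closed bounded_pred.
Proof.
split=> [|a f g /bounded_predP[M hM] /bounded_predP[N hN]]; apply/bounded_predP.
  by exists 0 => x; rewrite normr0.
exists (`|a| * M + N) => x; rewrite (le_trans (ler_normD _ _))// lerD//.
by rewrite normrM ler_wpM2l.
Qed.
HB.instance Definition _ :=
  GRing.isSubmodClosed.Build R (A -> R) bounded_pred bounded_pred_submod.

Record linf := Linf { linf_fun :> A -> R ; _ : linf_fun \in bounded_pred }.

HB.instance Definition _ := [isSub for linf_fun].
HB.instance Definition _ := [Choice of linf by <:].
HB.instance Definition _ := [SubChoice_isSubLmodule of linf by <:].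

Definition linf_norm (f : linf) : R := sup (range (fun x => `|f x|)).

Lemma linf_norm_ge (f : linf) x : `|f x| <= linf_norm f.
Proof.
apply: ub_le_sup; last by exists x.
by have /bounded_predP[M hM] := valP f; exists M => _ [y _ <-].
Qed.

Lemma linf_norm_ge0 (f : linf) : 0 <= linf_norm f.
Proof.
rewrite /linf_norm; have [->|/set0P[_ [x _ _]]] :=
  eqVneq (range (fun x => `|f x|)) set0; first by rewrite sup0.
exact: le_trans (normr_ge0 _) (linf_norm_ge f x).
Qed.

Lemma linf_norm_le (f : linf) M :
  0 <= M -> (forall x, `|f x| <= M) -> linf_norm f <= M.
Proof.
move=> M0 hM; rewrite /linf_norm.
have [->|/set0P[y Hy]] := eqVneq (range (fun x => `|f x|)) set0.
  by rewrite sup0.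
by apply: ge_sup; [exists y | move=> _ [x _ <-]].
Qed.

Lemma linf_normD (f g : linf) :
  linf_norm (f + g) <= linf_norm f + linf_norm g.
Proof.
apply: linf_norm_le => [|x]; first by rewrite addr_ge0 ?linf_norm_ge0.
by rewrite (le_trans (ler_normD _ _))// lerD// linf_norm_ge.
Qed.

Lemma linf_normZ (a : R) (f : linf) : linf_norm (a *: f) = `|a| * linf_norm f.
Proof.
have le b g : linf_norm (b *: g) <= `|b| * linf_norm g.
  apply: linf_norm_le => [|x]; first by rewrite mulr_ge0 ?linf_norm_ge0.
  by rewrite normrM ler_wpM2l// linf_norm_ge.
apply/eqP; rewrite eq_le le /=.
have [->|a0] := eqVneq a 0; first by rewrite normr0 mul0r linf_norm_ge0.
rewrite -ler_pdivlMl ?normr_gt0// -{1}[f](scalerK a0) -normfV.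
exact: le.
Qed.

Lemma linf_norm0_eq0 (f : linf) : linf_norm f = 0 -> f = 0.
Proof.
move=> f0; apply: val_inj; apply/funext => x /=; apply/eqP.
by rewrite -normr_le0 -f0 linf_norm_ge.
Qed.

HB.instance Definition _ :=
  Lmodule_isNormed.Build R linf linf_normD linf_normZ linf_norm0_eq0.

(* null functions on A; ['valL_0 f] is the extension of f by zero to nat *)
Definition null_pred : {pred linf} :=
  fun f => `[< 'valL_0 f @ \oo --> (0 : R) >].

Lemma null_predP (f : linf) :
  reflect (forall e, 0 < e -> \forall n \near \oo, `|'valL_0 f n| <= e)
    (f \in null_pred).
Proof.
apply: (iffP (asboolP _)) => [/cvgr0Pnorm_le//|h].
exact/cvgr0Pnorm_le.
Qed.

Lemma null_pred_submod : GRing.submod_closed null_pred.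
Proof.
split=> [|a f g].
  apply/null_predP => e e0; near=> n.
  by rewrite ext0E; case: insub => [x|] /=; rewrite normr0 ltW.
move=> /asboolP f0 /asboolP g0; apply/asboolP.
rewrite (_ : 'valL_0 _ = fun n => a * 'valL_0 f n + 'valL_0 g n); last first.
  apply/funext => n; rewrite !ext0E; case: insub => //=.
  by rewrite mulr0 addr0.
have := cvgD (cvgM (cvg_cst a) f0) g0.
by rewrite mulr0 addr0; exact.
Unshelve. all: by end_near. Qed.
HB.instance Definition _ :=
  GRing.isSubmodClosed.Build R linf null_pred null_pred_submod.

Record c0 := C0 { c0_linf :> linf ; _ : c0_linf \in null_pred }.

HB.instance Definition _ := [isSub for c0_linf].
HB.instance Definition _ := [Choice of c0 by <:].
HB.instance Definition _ := [SubChoice_isSubLmodule of c0 by <:].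

Definition c0_norm (f : c0) : R := `|c0_linf f|.

Lemma c0_normD (f g : c0) : c0_norm (f + g) <= c0_norm f + c0_norm g.
Proof. exact: ler_normD. Qed.

Lemma c0_normZ (a : R) (f : c0) : c0_norm (a *: f) = `|a| * c0_norm f.
Proof. exact: normrZ. Qed.

Lemma c0_norm0_eq0 (f : c0) : c0_norm f = 0 -> f = 0.
Proof. by move=> /normr0_eq0 f0; exact: val_inj. Qed.

HB.instance Definition _ :=
  Lmodule_isNormed.Build R c0 c0_normD c0_normZ c0_norm0_eq0.

Definition linf_c0 : Type := Quotient.quot null_pred.
HB.instance Definition _ := GRing.Zmodule.on linf_c0.

Definition cls (f : linf) : linf_c0 := \pi_(Quotient.quot null_pred) f.

Definition cls_repr (q : linf_c0) : linf := repr (q : Quotient.quot null_pred).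

Lemma cls_reprK : cancel cls_repr cls.
Proof. exact: reprK. Qed.

Lemma cls_eqP (f g : linf) : cls f = cls g <-> f - g \in null_pred.
Proof.
rewrite Quotient.idealrBE; split=> [/eqP//|/eqP//].
Qed.

Lemma clsD : {morph cls : f g / f + g}.
Proof. exact: raddfD. Qed.

Definition linf_c0_scale (a : R) (q : linf_c0) : linf_c0 :=
  cls (a *: cls_repr q).

Lemma cls_scale (a : R) f : linf_c0_scale a (cls f) = cls (a *: f).
Proof.
apply/cls_eqP; rewrite -scalerBr rpredZ//; apply/cls_eqP.
by rewrite cls_reprK.
Qed.

Lemma linf_c0_scaleA a b q :
  linf_c0_scale a (linf_c0_scale b q) = linf_c0_scale (a * b) q.
Proof. by rewrite -[q]cls_reprK !cls_scale scalerA. Qed.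

Lemma linf_c0_scale1 : left_id 1 linf_c0_scale.
Proof. by move=> q; rewrite -[q]cls_reprK cls_scale scale1r. Qed.

Lemma linf_c0_scaleDr : right_distributive linf_c0_scale +%R.
Proof.
move=> a p q; rewrite -[p]cls_reprK -[q]cls_reprK.
by rewrite -clsD !cls_scale -clsD scalerDr.
Qed.

Lemma linf_c0_scaleDl q : {morph linf_c0_scale^~ q : a b / a + b}.
Proof.
by move=> a b; rewrite -[q]cls_reprK !cls_scale -clsD scalerDl.
Qed.

HB.instance Definition _ := GRing.Zmodule_isLmodule.Build R linf_c0
  linf_c0_scaleA linf_c0_scale1 linf_c0_scaleDr linf_c0_scaleDl.

Definition linf_c0_norm (q : linf_c0) : R :=
  inf [set `|f| | f in [set f : linf | cls f = q]].

Lemma linf_c0_norm_le f : linf_c0_norm (cls f) <= `|f|.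
Proof.
by apply: ge_inf; [exists 0 => _ [g _ <-]; exact: normr_ge0|exists f].
Qed.

Lemma linf_c0_norm_lt q r :
  linf_c0_norm q < r -> exists2 f, cls f = q & `|f| < r.
Proof.
move=> /inf_lt; case; last by move=> _ [f fq <-] fr; exists f.
by exists `|cls_repr q|, (cls_repr q) => //; exact: cls_reprK.
Qed.

Lemma linf_c0_normD p q :
  linf_c0_norm (p + q) <= linf_c0_norm p + linf_c0_norm q.
Proof.
apply/ler_addgt0Pr => e e0.
have /linf_c0_norm_lt[f <- fe] : linf_c0_norm p < linf_c0_norm p + e / 2.
  by rewrite ltrDl divr_gt0.
have /linf_c0_norm_lt[g <- ge] : linf_c0_norm q < linf_c0_norm q + e / 2.
  by rewrite ltrDl divr_gt0.
rewrite -clsD (le_trans (linf_c0_norm_le _))// (le_trans (ler_normD _ _))//.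
rewrite [e in leRHS]splitr addrACA; apply: lerD; exact: ltW.
Qed.

Lemma linf_c0_norm_ge0 q : 0 <= linf_c0_norm q.
Proof.
apply: lb_le_inf; last by move=> _ [f _ <-].
by exists `|cls_repr q|, (cls_repr q) => //; exact: cls_reprK.
Qed.

Lemma linf_c0_normZ (a : R) q :
  linf_c0_norm (a *: q) = `|a| * linf_c0_norm q.
Proof.
have le b p : linf_c0_norm (b *: p) <= `|b| * linf_c0_norm p.
  apply/ler_addgt0Pr => e e0.
  have c0 : 0 < `|b| + 1 by rewrite ltr_wpDl.
  have /linf_c0_norm_lt[f fp fe] :
    linf_c0_norm p < linf_c0_norm p + e / (`|b| + 1).
    by rewrite ltrDl divr_gt0.
  rewrite -{1}fp [_ *: _]cls_scale (le_trans (linf_c0_norm_le _))// normrZ.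
  rewrite (le_trans (ler_wpM2l (normr_ge0 b) (ltW fe)))// mulrDr lerD2l.
  by rewrite mulrCA ger_pMr// ler_pdivrMr// mul1r lerDl.
apply/eqP; rewrite eq_le le /=.
have [->|a0] := eqVneq a 0; first by rewrite normr0 mul0r linf_c0_norm_ge0.
rewrite -ler_pdivlMl ?normr_gt0// -{1}[q](scalerK a0) -normfV.
exact: le.
Qed.

Lemma linf_c0_norm0_eq0 q : linf_c0_norm q = 0 -> q = 0.
Proof.
move=> q0; rewrite -[q]cls_reprK -[RHS](_ : cls 0 = 0); last exact: raddf0.
apply/cls_eqP; rewrite subr0; apply/null_predP => e e0.
have e20 : 0 < e / 2 by rewrite divr_gt0.
have /linf_c0_norm_lt[g gq ge] : linf_c0_norm q < e / 2 by rewrite q0.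
have /cls_eqP/null_predP/(_ _ e20) : cls (cls_repr q) = cls g.
  by rewrite gq cls_reprK.
apply: filterS => n; rewrite !ext0E; case: insub => [x|]/=; last first.
  by rewrite normr0 => _; exact: ltW.
move=> h; rewrite -[X in `|X|](subrK (g x)) (le_trans (ler_normD _ _))//.
rewrite [leRHS]splitr lerD// (le_trans _ (ltW ge))//.
exact: linf_norm_ge.
Qed.

HB.instance Definition _ := Lmodule_isNormed.Build R linf_c0
  linf_c0_normD linf_c0_normZ linf_c0_norm0_eq0.

End linf.
Arguments linf_fun {R A} _ _.
Arguments cls {R A} f.

Section transfer.
Context {R : realType}.
Implicit Types A B : set nat.

Lemma recut_bounded A B (f : linf R A) :
  sigL B ('valL_0 f) \in @bounded_pred R B.
Proof.
have /bounded_predP[M hM] := valP f.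
apply/bounded_predP; exists (Num.max M 0) => x.
rewrite -[sigL _ _ x]/('valL_0 f (set_val x)) ext0E.
by case: insub => [y|] /=; rewrite ?normr0 le_max ?hM ?lexx ?orbT.
Qed.

(* f is extended by zero outside A, then restricted to B: the restriction map
   if B is a subset of A, the extension by zero if A is a subset of B *)
Definition recut A B (f : linf R A) : linf R B := Linf (recut_bounded B f).

Lemma recut_null A B (f g : linf R A) :
  cls f = cls g -> cls (recut B f) = cls (recut B g).
Proof.
move=> /cls_eqP/null_predP fg; apply/cls_eqP/null_predP => e e0.
apply: filterS (fg _ e0) => n; rewrite !ext0E.
case: (@insubP _ _ B n) => [b _ bn|_ _] /=; last by rewrite normr0 ltW.
rewrite -[(_ - _) b]/('valL_0 f (set_val b) - 'valL_0 g (set_val b)).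
by rewrite !ext0E -bn; case: insub => //=; rewrite subrr.
Qed.

Definition qrecut A B (q : linf_c0 R A) : linf_c0 R B :=
  cls (recut B (cls_repr q)).

Lemma qrecutE A B (f : linf R A) : qrecut B (cls f) = cls (recut B f).
Proof. by apply: recut_null; rewrite cls_reprK. Qed.

Definition P_ B : linf_c0 R [set: nat] -> linf_c0 R B := @qrecut setT B.
Definition I_ A : linf_c0 R A -> linf_c0 R [set: nat] := @qrecut A setT.

Definition localization B A (T : linf_c0 R [set: nat] -> linf_c0 R [set: nat])
  : linf_c0 R A -> linf_c0 R B := @P_ B \o T \o @I_ A.

(* V read through the canonical identifications with the quotients over the
   cofinite subsets A' of A and B' of B *)
Definition identify A B A' B' (V : linf_c0 R A -> linf_c0 R B)
  : linf_c0 R A' -> linf_c0 R B' := @qrecut B B' \o V \o @qrecut A' A.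

Lemma compose_bounded A B (s : B -> A) (f : linf R A) :
  f \o s \in @bounded_pred R B.
Proof.
have /bounded_predP[M hM] := valP f; apply/bounded_predP.
by exists M => x; exact: hM.
Qed.

Definition linf_comp A B (s : B -> A) (f : linf R A) : linf R B :=
  Linf (compose_bounded s f).

End transfer.
Arguments recut {R} A B f.
Arguments qrecut {R} A B q.
Arguments P_ {R} B q.
Arguments I_ {R} A q.
Arguments localization {R} B A T q.
Arguments identify {R A B} A' B' V q.
Arguments linf_comp {R A B} s f.

Definition operator (R : realType) (U V : normedModType R) (f : U -> V) : Prop :=
  linear f /\ exists M, forall x, `|f x| <= M * `|x|.

Definition isomorphism (R : realType) (U V : normedModType R) (f : U -> V)
  : Prop :=
  [/\ linear f, continuous f
    & exists g : V -> U, [/\ cancel f g, cancel g f & continuous g]].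

Definition automorphism (R : realType) (U : normedModType R) (f : U -> U) :=
  isomorphism f.

Definition cofinite_in (A' A : set nat) : Prop :=
  A' `<=` A /\ finite_set (A `\` A').

Section operators.
Context {R : realType} {A B : set nat} (V : linf_c0 R A -> linf_c0 R B).

Definition is_lifting (A' B' : set nat) (S : linf R A' -> linf R B') : Prop :=
  [/\ cofinite_in A' A, cofinite_in B' B, operator S
    & forall f, identify A' B' V (cls f) = cls (S f)].

Definition liftable : Prop :=
  exists (A' B' : set nat) (S : linf R A' -> linf R B'), is_lifting S.

(* g = b f, each row series summed along the increasing enumeration of A' *)
Definition matrix_image (A' B' : set nat) (b : B' -> A' -> R)
    (f : A' -> R) (g : B' -> R) : Prop :=
  forall i, series ('valL_0 (fun j => b i j * f j)) @ \oo --> g i.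

Definition matrix_operator : Prop :=
  exists (A' B' : set nat) (b : B' -> A' -> R),
  [/\ cofinite_in A' A, cofinite_in B' B,
      exists2 U : c0 R A' -> c0 R B', operator U
        & forall f : c0 R A', matrix_image b f (U f)
    & forall f : linf R A', exists2 g : linf R B', matrix_image b f g
        & identify A' B' V (cls f) = cls g].

Definition trivial_operator : Prop :=
  exists (A' B' : set nat) (s : B' -> A') (r : R),
  [/\ cofinite_in A' A, cofinite_in B' B, bijective s, r != 0
    & forall f : linf R A', identify A' B' V (cls f) = cls (r *: linf_comp s f)].
End operators.

(* linf A with the topology inherited from the product topology of R^A *)
Definition pw_linf (R : realType) (A : set nat) : Type :=
  initial_topology (@linf_fun R A : _ -> {ptws A -> R}).
HB.instance Definition _ (R : realType) (A : set nat) :=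
  Topological.on (pw_linf R A).

Definition unit_ball (R : realType) (A : set nat) : set (linf R A) :=
  [set f | `|f| <= 1].

Definition product_continuous_on_ball (R : realType) (A B : set nat)
    (S : linf R A -> linf R B) : Prop :=
  {within (@unit_ball R A : set (pw_linf R A)),
    continuous (S : pw_linf R A -> pw_linf R B)}.

(* Main.v *)
From HB Require Import structures.
Require Import Defs.
From mathcomp Require Import all_boot all_order all_algebra.
From mathcomp Require Import all_classical all_reals all_analysis.
From mathcomp Require Import zify ring lra.
Import Order.TTheory GRing.Theory Num.Theory.
Import numFieldNormedType.Exports.

(** The four conditions turn out to be equivalent to a fifth, which is exact
    rather than up to finite sets: for some infinite [A] and [B], the
    localization of [T] to [(A, B)] sends the class of [f] to the class of
    [r f o s], where [s : B -> A] is a bijection and [r != 0]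
    ([scaled_bijection]).  Such a map is visibly an isomorphism, a matrix
    operator (one nonzero entry in each row), liftable by a pointwise continuous
    lifting, and trivial; conversely a trivial localization becomes one of these
    once [A] and [B] are shrunk to the cofinite sets of the definition.  A matrix
    operator is liftable because the bound of the matrix on null sequences passes
    to the row sums of bounded ones ([matrix_liftable]).  All that remains is to
    extract, from a liftable isomorphism, infinite sets on which it is a scaled
    bijection ([exists_scaled_bijection]).

    Let [S] be the lifting, and view its rows [f |-> S f i] as bounded
    functionals of bounded sequences.  Such a functional splits into an l_1 part
    and a part that vanishes on c_0.  The second part disappears on a suitable
    infinite set: if [A_x] is an uncountable almost disjoint family of infinite
    sets, then for each row and each [e > 0] only finitely many of the [A_x]
    carry functions of norm one with arbitrarily late supports and values above
    [e], since after finite truncations such functions have disjoint supports and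
    can be added up at no cost in norm.  There are countably many rows, so some
    [A_x] is good for all of them ([exists_negligible_tails]).

    Now the rows have small tails, and the columns tend to 0 because [S] maps c_0
    into c_0.  A gliding hump argument thins the good set out to
    [j_0 < j_1 < ...] so that every row sees a single coordinate, up to an error
    tending to 0: row [i] is close to [f |-> c_i f(j_k)], with [k = k(i)] tending
    to infinity ([gliding_hump]).  If [c_i] tended to 0, then [S] would map the
    indicator of [{j_0, j_1, ...}] into c_0, against injectivity.  Hence [c_i]
    has a nonzero cluster point [r], and a subsequence of rows along which [c_i]
    tends to [r] and [k(i)] increases gives the bijection
    ([scaled_subsequence]). *)

Set Implicit Arguments.
Unset Strict Implicit.
Unset Printing Implicit Defensive.

Local Open Scope classical_set_scope.
Local Open Scope ring_scope.

(** * Sets of natural numbers *)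

Definition unbounded (X : set nat) := forall N, exists2 n, X n & (N <= n)%N.

Lemma infinite_unbounded (X : set nat) : infinite_set X <-> unbounded X.
Proof.
split=> [Xinf N|Xub /finite_seqP[s sX]].
  apply: contrapT => h; apply: Xinf; apply: sub_finite_set (finite_II N).
  by move=> n Xn /=; rewrite ltnNge; apply/negP => Nn; apply: h; exists n.
have [n] := Xub (\max_(i <- s) i).+1; rewrite sX /= => ns.
by rewrite ltnNge leq_bigmax_seq.
Qed.

Lemma infinite_range (T : Type) (f : nat -> T) :
  injective f -> infinite_set (range f).
Proof.
move=> finj /(finite_preimage (in2W finj)).
by rewrite preimage_range; exact: infinite_nat.
Qed.

Lemma increasing_ltn (u : nat -> nat) :
  increasing_seq u -> forall m n, (u m < u n)%N = (m < n)%N.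
Proof. by move=> hu m n; rewrite !ltnNge -!leEnat hu. Qed.

Lemma increasing_ge (u : nat -> nat) :
  increasing_seq u -> forall n, (n <= u n)%N.
Proof.
move=> /increasing_ltn hu; elim=> // n IH.
by apply: leq_ltn_trans IH _; rewrite hu.
Qed.

Lemma increasing_inj (u : nat -> nat) : increasing_seq u -> injective u.
Proof.
move=> /increasing_ltn hu m n mn; case: (ltngtP m n) => //.
  by rewrite -hu mn ltnn.
by rewrite -hu mn ltnn.
Qed.

Lemma increasingS (u : nat -> nat) :
  (forall n, (u n < u n.+1)%N) -> increasing_seq u.
Proof. by move=> h; apply/increasing_seqP => n; rewrite ltEnat; exact: h. Qed.

Section almost_disjoint.
Variable X : set nat.
Hypothesis Xinf : infinite_set X.

(** [F x] consists of the codes of the finite initial segments of [x], carried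
    into [X] by an increasing enumeration.  Two branches share only the segments
    that stop before their first disagreement. *)
Lemma almost_disjoint_family : exists F : (nat -> bool) -> set nat,
  [/\ forall x, F x `<=` X, forall x, infinite_set (F x)
    & forall x y, x != y -> exists N, forall n, F x n -> F y n -> (n < N)%N].
Proof.
have [|e [einc _ eX]] := @infinite_increasing_seq_wf _ nat X _ Xinf 0%N.
  by move=> n; apply: sub_finite_set (finite_II n.+1) => m /=; rewrite ltnS.
pose F (x : nat -> bool) := range (fun n => e (pickle (mkseq x n))).
have codeK n m (x y : nat -> bool) :
    e (pickle (mkseq x n)) = e (pickle (mkseq y m)) -> mkseq x n = mkseq y m.
  by move=> /(increasing_inj einc)/(pcan_inj pickleK).
exists F; split=> [x _ [n _ <-]|x|x y xy]; first exact: eX.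
  apply: infinite_range => m n /codeK /(congr1 size).
  by rewrite !size_mkseq.
have [k xyk] : exists k, x k != y k.
  apply: contrapT => h; move/eqP: xy; apply; apply/funext => k.
  by apply/eqP/negPn/negP => xyk; apply: h; exists k.
exists (\max_(i < k.+1) e (pickle (mkseq x i))).+1.
move=> _ [n _ <-] [m _ /codeK mn].
have nm : n = m by have := congr1 size mn; rewrite !size_mkseq => ->.
have nk : (n < k.+1)%N.
  rewrite ltnS leqNgt; apply/negP => kn; move/negP: xyk; apply; apply/eqP.
  have := congr1 (fun s => nth false s k) mn.
  by rewrite -nm !nth_mkseq.
by rewrite ltnS (leq_bigmax (Ordinal nk)).
Qed.
End almost_disjoint.

Lemma uncountable_bool_sequences : ~ countable [set: nat -> bool].
Proof.
move=> /countable_injP[g ginj].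
(* Cantor's diagonal sequence for the coding [g] *)
pose x n := `[< forall y, g y = n -> y n = false >].
have xg : x (g x) = ~~ x (g x).
  rewrite {1}/x; apply/asboolP/idP => [h|xF y yx]; first by rewrite h.
  by rewrite (ginj y x) ?inE //; apply/negbTE.
by case: (x (g x)) xg.
Qed.

(** * Bounded functionals on bounded sequences *)

Section functionals.
Context {R : realType}.
Implicit Types (f g : nat -> R) (X : set nat) (phi : (nat -> R) -> R) (M e : R).

Definition bdd f := exists C, forall n, `|f n| <= C.
Definition in_ball f := forall n, `|f n| <= 1.
Definition supp_in f X := forall n, f n != 0 -> X n.

(** [phi] stands for a functional of norm at most [M] on the bounded sequences;
    its values on unbounded functions are junk, hence the restrictions. *)
Definition bounded_functional M phi :=
  (forall a f g, bdd f -> bdd g -> phi (a *: f + g) = a * phi f + phi g)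
  /\ (forall f, in_ball f -> `|phi f| <= M).

(** The restriction of [phi] to the functions carried by [X] is given by an
    absolutely summable sequence. *)
Definition negligible_tails X phi := forall e, 0 < e -> exists N, forall f,
  in_ball f -> supp_in f (X `&` [set n | (N <= n)%N]) -> `|phi f| <= e.

Lemma in_ball_bdd f : in_ball f -> bdd f. Proof. by exists 1. Qed.

Lemma in_ball0 : in_ball 0. Proof. by move=> n; rewrite normr0. Qed.

Lemma in_ball_cut (P : pred nat) f :
  in_ball f -> in_ball (fun n => if P n then f n else 0).
Proof. by move=> fb n; case: ifP => _; rewrite ?normr0. Qed.

Lemma in_ball_delta k : in_ball (fun n => (n == k)%:R).
Proof. by move=> n; case: eqP => _; rewrite ?normr1 ?normr0. Qed.

Lemma supp_inE f X n : supp_in f X -> ~ X n -> f n = 0.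
Proof. by move=> fX Xn; apply/eqP/negPn/negP => /fX. Qed.

Section one.
Variables (M : R) (phi : (nat -> R) -> R).
Hypothesis hphi : bounded_functional M phi.

Lemma functional0 : phi 0 = 0.
Proof.
have b0 := in_ball_bdd in_ball0; have := hphi.1 1 0 0 b0 b0.
rewrite scaler0 addr0 mul1r => /(congr1 (fun x => x - phi 0)).
by rewrite subrr addrK => <-.
Qed.

Lemma functionalD f g : bdd f -> bdd g -> phi (f + g) = phi f + phi g.
Proof. by move=> bf bg; rewrite -[f]scale1r hphi.1 // mul1r scale1r. Qed.

Lemma functionalZ a f : bdd f -> phi (a *: f) = a * phi f.
Proof.
move=> bf; rewrite -[a *: f]addr0 hphi.1 //; last exact: (in_ball_bdd in_ball0).
by rewrite functional0 addr0.
Qed.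

(** Unit functions carried by late parts of different [F x] have disjoint
    supports, so they can be added, with signs making their values positive,
    without leaving the unit ball.  The parameter [N] lets the induction place
    the pieces chosen so far beyond the intersections with the next one. *)
Lemma disjoint_pieces (I : eqType) (F : I -> set nat) e (s : seq I) N :
  (forall x y, x != y -> exists N, forall n, F x n -> F y n -> (n < N)%N) ->
  uniq s ->
  (forall x, x \in s -> forall N, exists f,
     [/\ in_ball f, supp_in f (F x `&` [set n | (N <= n)%N]) & e < `|phi f|]) ->
  exists f, [/\ in_ball f,
    supp_in f [set n | (N <= n)%N /\ exists2 x, x \in s & F x n]
    & (size s)%:R * e <= phi f].
Proof.
move=> ad; elim: s N => [|x s IH] N /=.
  move=> _ _; exists 0; split; first exact: in_ball0.
    by move=> n; rewrite eqxx.
  by rewrite mul0r functional0.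
move=> /andP[xs us] bad.
have [N' NN' sep] : exists2 N', (N <= N')%N &
    forall y, y \in s -> forall n, F x n -> F y n -> (n < N')%N.
  elim: (s) xs => [|y t IHt]; first by exists N.
  rewrite inE negb_or => /andP[xy /IHt[N1 NN1 h1]].
  have [N2 h2] := ad _ _ xy; exists (maxn N1 N2).
    by rewrite leq_max NN1.
  move=> z; rewrite inE => /orP[/eqP ->|zt] n Fx Fz; rewrite leq_max.
    by rewrite (h2 _ Fx Fz) orbT.
  by rewrite (h1 _ zt _ Fx Fz).
have [|f [fb fs fe]] := IH N' us.
  by move=> y ys; apply: bad; rewrite inE ys orbT.
have [g [gb gs ge]] := bad x (mem_head _ _) N'.
pose sg : R := Num.sg (phi g).
have sg1 : `|sg| <= 1 by rewrite normr_sg; case: (_ != 0).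
exists (sg *: g + f); split.
- move=> n; rewrite -[(_ + _) n]/(sg * g n + f n).
  have [gn|gn] := eqVneq (g n) 0; first by rewrite gn mulr0 add0r.
  rewrite (supp_inE fs) ?addr0 ?normrM ?mulr_ile1//.
  move=> /= [N'n [y ys Fy]]; have [Fx _] := gs _ gn.
  by have := sep _ ys _ Fx Fy; rewrite ltnNge N'n.
- move=> n; rewrite -[(_ + _) n]/(sg * g n + f n) => h /=.
  have [gn|gn] := eqVneq (g n) 0.
    move: h; rewrite gn mulr0 add0r => /fs[/= N'n [y ys Fy]].
    by split; [exact: leq_trans N'n|exists y; rewrite // inE ys orbT].
  have [Fx N'n] := gs _ gn.
  by split; [exact: leq_trans N'n|exists x; rewrite // mem_head].
- rewrite hphi.1; [|exact: in_ball_bdd..].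
  rewrite -natr1 mulrDl mul1r addrC lerD // /sg -normrEsg; exact: ltW.
Qed.

(** Each such [x] contributes at least [e] to the value of a single function of
    the unit ball, so there are at most [M / e] of them. *)
Lemma finite_nonnegligible (I : choiceType) (F : I -> set nat) e :
  (forall x y, x != y -> exists N, forall n, F x n -> F y n -> (n < N)%N) ->
  0 < e ->
  finite_set [set x | forall N, exists f,
     [/\ in_ball f, supp_in f (F x `&` [set n | (N <= n)%N]) & e < `|phi f|]].
Proof.
move=> ad e0; apply: contrapT => bad.
have [B Bbad sB] := infinite_set_fset (Num.truncn (M / e)).+1 bad.
have [|f [fb _]] := disjoint_pieces 0 ad (finmap.fset_uniq B) (e := e).
  by move=> x xB; exact: (Bbad x xB).
apply/negP; rewrite -ltNge; apply: le_lt_trans (ler_norm _) _.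
apply: le_lt_trans (hphi.2 _ fb) _; rewrite -ltr_pdivrMr //.
apply: lt_le_trans (truncnS_gt _) _.
by rewrite ler_nat.
Qed.
End one.

(** Only countably many members of an uncountable almost disjoint family are bad
    for some row and some threshold [k.+1%:R^-1]. *)
Lemma exists_negligible_tails M (phi : nat -> (nat -> R) -> R) X :
  (forall i, bounded_functional M (phi i)) -> infinite_set X ->
  exists Y, [/\ Y `<=` X, infinite_set Y & forall i, negligible_tails Y (phi i)].
Proof.
move=> hphi Xinf; have [F [FX Finf Fad]] := almost_disjoint_family Xinf.
pose bad (p : nat * nat) := [set x | forall N, exists f,
  [/\ in_ball f, supp_in f (F x `&` [set n | (N <= n)%N])
    & p.2.+1%:R^-1 < `|phi p.1 f|]].
have : countable (\bigcup_p bad p).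
  apply: bigcup_countable => // p _; apply: finite_set_countable.
  by apply: finite_nonnegligible; [exact: hphi|exact: Fad|].
have [allbad cbad|] := pselect (forall x, (\bigcup_p bad p) x).
  case: uncountable_bool_sequences; apply: sub_countable cbad.
  by apply: subset_card_le => x _.
move=> /existsNP[x xgood] _; exists (F x); split=> // i e e0.
have [k ke] : exists k, k.+1%:R^-1 < e.
  exact: (filter_ex (near_infty_natSinv_lt (PosNum e0))).
apply: contrapT => tail; apply: xgood; exists (i, k) => // N.
apply: contrapT => h; apply: tail; exists N => f fb fs.
apply: le_trans (ltW ke); rewrite leNgt; apply/negP => lt.
by apply: h; exists f.
Qed.

Definition delta (k : nat) : nat -> R := fun n => (n == k)%:R.

Definition chi (Y : set nat) : nat -> R := fun n => (n \in Y)%:R.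

Lemma in_ball_chi (Y : set nat) : in_ball (chi Y).
Proof. by move=> n; rewrite /chi; case: (n \in Y); rewrite ?normr1 ?normr0. Qed.

Lemma supp_chi (Y : set nat) : supp_in (chi Y) Y.
Proof.
move=> n; rewrite /chi.
by case: (boolP (n \in Y)) => [/set_mem//|]; rewrite eqxx.
Qed.

Lemma cvg0P (u : nat -> R) : (u @ \oo --> (0 : R)) <->
  (forall e, 0 < e -> exists N, forall n, (N <= n)%N -> `|u n| <= e).
Proof.
split=> [/cvgr0Pnorm_le h e /h[N _ hN]|h]; first by exists N.
by apply/cvgr0Pnorm_le => e /h[N hN]; exists N.
Qed.

(** * The gliding hump *)

Section rows.
Variables (M : R) (phi : nat -> (nat -> R) -> R) (X : set nat).
Hypothesis hphi : forall i, bounded_functional M (phi i).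
Hypothesis columns : forall j, phi^~ (delta j) @ \oo --> (0 : R).

(** Functions carried by [[0, J[] live in a finite-dimensional space, so the
    pointwise convergence of the rows to 0 is uniform on its unit ball. *)
Lemma small_heads J e : 0 < e -> exists n, forall i f, (n <= i)%N ->
  in_ball f -> supp_in f [set n | (n < J)%N] -> `|phi i f| <= e.
Proof.
elim: J e => [|J IH] e e0.
  exists 0%N => i f _ _ fs; rewrite (_ : f = 0).
    by rewrite (functional0 (hphi i)) normr0 ltW.
  by apply/funext => n; apply: supp_inE fs _.
have e20 : 0 < e / 2 by rewrite divr_gt0.
have [n1 h1] := IH _ e20.
have /cvg0P/(_ _ e20)[n2 h2] := columns J.
exists (maxn n1 n2) => i f; rewrite geq_max => /andP[i1 i2] fb fs.
pose g n := if (n < J)%N then f n else 0.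
have gb : in_ball g by exact: in_ball_cut.
have -> : f = f J *: delta J + g.
  apply/funext => n; rewrite -[(_ + _) n]/(f J * (n == J)%:R + g n) /g.
  case: ltngtP => [_|Jn|->]; rewrite ?mulr0 ?add0r ?mulr1 ?addr0 //.
  by apply: supp_inE fs _ => /=; rewrite ltnS leqNgt Jn.
rewrite (hphi i).1; [|exact: (in_ball_bdd (in_ball_delta _))|exact: in_ball_bdd].
apply: le_trans (ler_normD _ _) _; rewrite [e]splitr lerD //.
  by rewrite normrM (le_trans _ (h2 i i2)) // ler_piMl.
by apply: h1 => // n; rewrite /g /=; case: ifP => //; rewrite eqxx.
Qed.

Hypothesis tails : forall i, negligible_tails X (phi i).

Lemma uniform_tails m e : 0 < e -> exists N, forall i f, (i < m)%N ->
  in_ball f -> supp_in f (X `&` [set n | (N <= n)%N]) -> `|phi i f| <= e.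
Proof.
move=> e0; elim: m => [|m [N hN]]; first by exists 0%N.
have [N' hN'] := tails m e0; exists (maxn N N') => i f.
rewrite ltnS leq_eqVlt => /orP[/eqP ->|im] fb fs.
  apply: hN' => // n /fs[Xn /=]; rewrite geq_max => /andP[_ ?]; by split.
apply: hN => // n /fs[Xn /=]; rewrite geq_max => /andP[? _]; by split.
Qed.

Hypothesis Xinf : infinite_set X.

(** [j] and [m] are chosen alternately: [j k] is so large that the rows before
    the previous row index nearly vanish on what lies beyond [j k] in [X], then
    [m k] is so large that all later rows nearly vanish on [[0, j k]].  Between
    [m k] and [m k.+1] both estimates leave out the coordinate [j k.+1] only. *)
Lemma gliding_hump : exists j m : nat -> nat,
  [/\ increasing_seq j, increasing_seq m, forall k, X (j k)
    & forall k i f, (m k <= i < m k.+1)%N -> in_ball f -> supp_in f (range j) ->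
      `|phi i f - f (j k.+1) * phi i (delta (j k.+1))| <= 2 / k.+1%:R].
Proof.
have step (p : nat * (nat * nat)) : exists q : nat * nat,
  [/\ X q.1, (p.2.1 < q.1)%N, (p.2.2 < q.2)%N,
    (forall i f, (i < p.2.2)%N -> in_ball f ->
      supp_in f (X `&` [set n | (q.1 <= n)%N]) -> `|phi i f| <= p.1.+1%:R^-1)
  & (forall i f, (q.2 <= i)%N -> in_ball f ->
      supp_in f [set n | (n < q.1.+1)%N] -> `|phi i f| <= p.1.+1%:R^-1)].
  case: p => k [J m] /=.
  have k0 : 0 < k.+1%:R^-1 :> R by [].
  have [N hN] := uniform_tails m k0.
  have [J' XJ'] := (infinite_unbounded X).1 Xinf (maxn J.+1 N).
  rewrite geq_max => /andP[JJ' NJ'].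
  have [m' hm'] := small_heads J'.+1 k0.
  exists (J', (maxn m.+1 m')); split=> //=; first by rewrite leq_max leqnn.
    move=> i f im fb fs; apply: hN im fb _ => n /fs[Xn /= J'n].
    by split=> //=; exact: leq_trans J'n.
  by move=> i f; rewrite geq_max => /andP[_]; exact: hm'.
have [g gP] := choice step.
pose fix u k := if k is k'.+1 then g (k', u k') else (0%N, 0%N).
have uP k := gP (k, u k).
exists (fun k => (u k.+1).1), (fun k => (u k.+1).2).
have jinc : increasing_seq (fun k => (u k.+1).1).
  by apply: increasingS => k; have [] := uP k.+1.
split=> // [|k|k i f /andP[ki ik] fb fs].
- by apply: increasingS => k; have [] := uP k.+1.
- by have [] := uP k.
set j := fun k => (u k.+1).1 in jinc fs *.
(* [m k.+1] is the second component of [u k.+2], so the tail estimate that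
   covers row [i] is the one made when [j k.+2] was chosen. *)
have [_ _ _ _ head] := uP k; have [_ _ _ tail _] := uP k.+2.
pose f1 n := if (n < (j k).+1)%N then f n else 0.
pose f2 n := if (j k.+2 <= n)%N then f n else 0.
have f1b : in_ball f1 by exact: in_ball_cut.
have f2b : in_ball f2 by exact: in_ball_cut.
have fE : f = f (j k.+1) *: delta (j k.+1) + (f1 + f2).
  apply/funext => n.
  rewrite -[RHS]/(f (j k.+1) * (n == j k.+1)%:R + (f1 n + f2 n)) /f1 /f2.
  have [fn|/fs[l _ <-]] := eqVneq (f n) 0.
    rewrite fn; case: eqP => [<-|_]; rewrite ?fn ?mulr0 ?mul0r ?add0r;
    by do 2 case: ifP; rewrite ?addr0.
  rewrite -/(j l) (inj_eq (increasing_inj jinc)) ltnS.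
  have jle a b : (j a <= j b)%N = (a <= b)%N by exact: jinc.
  rewrite !jle; have [lk|kl|->] := ltngtP l k.+1; rewrite ?mulr0 ?mulr1 ?add0r.
  + have -> : (l <= k)%N by lia.
    by rewrite addr0.
  + have -> : (l <= k)%N = false by lia.
    by rewrite add0r.
  + by rewrite ltnn !addr0.
have -> : phi i f = f (j k.+1) * phi i (delta (j k.+1)) + (phi i f1 + phi i f2).
  rewrite {1}fE (hphi i).1.
  - by rewrite (functionalD (hphi i)) //; exact: in_ball_bdd.
  - exact: (in_ball_bdd (in_ball_delta _)).
  - exists (1 + 1) => n; apply: le_trans (ler_normD _ _) _.
    by rewrite lerD ?f1b ?f2b.
rewrite addrC addKr (le_trans (ler_normD _ _)) //.
have h1 : `|phi i f1| <= k.+1%:R^-1.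
  apply: head => // n; rewrite /f1 /= ; case: ifP => //; by rewrite eqxx.
have h2 : `|phi i f2| <= k.+1%:R^-1.
  apply: (@le_trans _ _ k.+3%:R^-1); last first.
    by rewrite lef_pV2 ?posrE ?ltr0n // ler_nat; lia.
  apply: tail => // n; rewrite /f2 /=.
  case: ifP => [jn /fs[l _ ln]|]; last by rewrite eqxx.
  by split=> //; rewrite -ln; have [] := uP l.
by rewrite mulrDl mul1r lerD.
Qed.

End rows.

Lemma increasing_block (m : nat -> nat) K i : increasing_seq m ->
  (m K <= i)%N -> exists2 k, (K <= k)%N & (m k <= i < m k.+1)%N.
Proof.
move=> minc; elim: i => [|i IH] Ki.
  exists K => //; rewrite Ki /=; apply: leq_trans (increasing_ge minc _).
  by [].
have [/IH[k Kk /andP[ki ik]]|iK] := leqP (m K) i.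
  have [?|ik'] := ltnP i.+1 (m k.+1); first by exists k; rewrite // (leqW ki).
  exists k.+1; first exact: leqW.
  by rewrite ik' (leq_ltn_trans ik) // (increasing_ltn minc).
exists K => //; rewrite Ki /=; apply: leq_ltn_trans iK _.
by rewrite (increasing_ltn minc).
Qed.

Lemma bounded_cluster (c : nat -> R) C : (forall n, `|c n| <= C) ->
  exists r, forall e, 0 < e -> forall K, exists2 n, (K <= n)%N & `|c n - r| < e.
Proof.
move=> cC.
have [|r [_ cr]] := @segment_compact R (- C) C (c @ \oo) _ _.
  by exists 0%N => // n _; rewrite /= in_itv /= -ler_norml.
exists r => e e0 K.
have [_ [[n /= Kn <-]]] := cr [set c n | n in [set n | (K <= n)%N]] (ball r e)
  (ex_intro2 _ _ K I (fun n Kn => ex_intro2 _ _ n Kn erefl)) (nbhsx_ballx r e e0).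
by rewrite -ball_normE /= distrC => ?; exists n.
Qed.

(** The last hypothesis is what injectivity of an operator modulo null sequences
    says about its rows; it prevents the dominant entries of the rows from
    tending to 0. *)
Lemma scaled_subsequence M (phi : nat -> (nat -> R) -> R) X :
  (forall i, bounded_functional M (phi i)) ->
  (forall j, phi^~ (delta j) @ \oo --> (0 : R)) ->
  infinite_set X ->
  (forall Y, Y `<=` X -> infinite_set Y ->
    ~ (phi^~ (chi Y) @ \oo --> (0 : R))) ->
  exists (a b : nat -> nat) (r : R),
  [/\ increasing_seq a, increasing_seq b, r != 0,
    forall k, X (a k) /\ phi (b k) (delta (a k)) != 0
  & forall f, bdd f -> supp_in f (range a) ->
      (fun k => phi (b k) f - r * f (a k)) @ \oo --> (0 : R)].
Proof.
move=> hphi columns /(exists_negligible_tails hphi)[X' [X'X X'inf tails]] inj.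
have [j [m [jinc minc X'j hump]]] := gliding_hump hphi columns tails X'inf.
have invS n : 0 < n.+1%:R^-1 :> R by [].
have invS_small e : 0 < e -> exists n, n.+1%:R^-1 < e.
  by move=> e0; exact: (filter_ex (near_infty_natSinv_lt (PosNum e0))).
have invS_le p q : (p <= q)%N -> q.+1%:R^-1 <= p.+1%:R^-1 :> R.
  by move=> pq; rewrite lef_pV2 ?posrE ?ltr0n // ler_nat.
have [e e0 big] : exists2 e, 0 < e & forall K, exists p : nat * nat,
    [/\ (K <= p.1)%N, (m p.1 <= p.2 < m p.1.+1)%N
      & e < `|phi p.2 (delta (j p.1.+1))|].
  apply: contrapT => small; apply: (inj (range j)).
  - by move=> _ [k _ <-]; exact/X'X/X'j.
  - exact: infinite_range (increasing_inj jinc).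
  apply/cvg0P => e e0.
  have e20 : 0 < e / 2 by rewrite divr_gt0.
  have [n0 hn0] := invS_small _ (divr_gt0 e20 (ltr0Sn R 1)).
  have [n1 hn1] : exists n1, forall k i, (n1 <= k)%N -> (m k <= i < m k.+1)%N ->
      `|phi i (delta (j k.+1))| <= e / 2.
    apply: contrapT => h; apply: small; exists (e / 2) => // K.
    apply: contrapT => hK; apply: h; exists K => k i Kk kik.
    by rewrite leNgt; apply/negP => lt; apply: hK; exists (k, i).
  exists (m (maxn n0 n1)) => i /(increasing_block minc)[k].
  rewrite geq_max => /andP[k0 k1] kik.
  have := hump _ _ _ kik (in_ball_chi _) (@supp_chi _).
  rewrite /chi mem_set ?mul1r; last by exists k.+1.
  move=> h; have := hn1 _ _ k1 kik; have := invS_le _ _ k0.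
  move: h hn0; set A := phi i _; set B := phi i _.
  have := ler_normD (A - B) B; rewrite subrK.
  set u := n0.+1%:R^-1; set v := k.+1%:R^-1; lra.
have [h hP] := choice big.
pose c K := phi (h K).2 (delta (j (h K).1.+1)).
have cM K : `|c K| <= M by apply: (hphi _).2; exact: in_ball_delta.
have [r rP] := bounded_cluster cM.
have sel (p : nat * nat) : exists K, (p.2 <= K)%N /\ `|c K - r| < p.1.+1%:R^-1.
  by have [K ? ?] := rP _ (invS p.1) p.2; exists K.
have [s sP] := choice sel.
(* Since [K <= (h K).1], searching from [(h (v l')).1.+1] on makes the selected
   coordinates increase. *)
pose fix v l := if l is l'.+1 then s (l, (h (v l')).1.+1) else s (0%N, 0%N).
have vc l : `|c (v l) - r| < l.+1%:R^-1.
  by case: l => [|l] /=; [exact: (sP (_, _)).2|exact: (sP (_, _)).2].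
pose k l := (h (v l)).1; pose b l := (h (v l)).2.
have kinc : increasing_seq k.
  apply: increasingS => l; have [le _ _] := hP (v l.+1).
  by apply: leq_trans le; exact: (sP (_, _)).1.
have kb l : (m (k l) <= b l < m (k l).+1)%N by have [] := hP (v l).
have phie l : e < `|phi (b l) (delta (j (k l).+1))| by have [] := hP (v l).
exists (fun l => j (k l).+1), b, r; split.
- apply: increasingS => l; rewrite (increasing_ltn jinc) ltnS.
  by rewrite (increasing_ltn kinc).
- apply: increasingS => l.
  have /andP[_ h1] := kb l; have /andP[h2 _] := kb l.+1.
  apply: leq_trans h1 (leq_trans _ h2); have := minc (k l).+1 (k l.+1).
  by rewrite !leEnat => ->; rewrite (increasing_ltn kinc).
- apply/eqP => r0; have [n _] := rP _ e0 0%N.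
  by rewrite r0 subr0 ltNge ltW //; have [] := hP n.
- move=> l; split; first exact/X'X/X'j.
  by rewrite -normr_gt0; exact: lt_trans (phie l).
move=> f [C fC] fs; pose C' := `|C| + 1.
have C'0 : 0 < C' by rewrite ltr_wpDl.
have fC' n : `|f n| <= C'.
  by apply: le_trans (fC n) _; apply: le_trans (ler_norm _) _; rewrite lerDl.
(* The row estimates hold on the unit ball, so [f] is rescaled into it. *)
pose g := C'^-1 *: f.
have gE n : g n = C'^-1 * f n by [].
have gb : in_ball g.
  by move=> n; rewrite gE normrM gtr0_norm ?invr_gt0 // ler_pdivrMl // mulr1.
have gs : supp_in g (range j).
  move=> n; rewrite gE mulf_eq0 => /norP[_ /fs[l _ <-]].
  by exists (k l).+1.
apply/cvg0P => d d0.
have d0' : 0 < d / C' / 3 by rewrite !divr_gt0.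
have [N hN] := invS_small _ d0'; exists N => l Nl.
have -> : phi (b l) f - r * f (j (k l).+1) =
    C' * (phi (b l) g - r * g (j (k l).+1)).
  have -> : f = C' *: g by rewrite /g scalerA divff ?scale1r // gt_eqF.
  rewrite (functionalZ (hphi _)); last exact: in_ball_bdd.
  rewrite -[(C' *: g) _]/(C' * g _) mulrBr; congr (_ - _).
  by rewrite mulrCA.
rewrite normrM gtr0_norm // mulrC -ler_pdivlMr //.
have h1 := hump _ _ _ (kb l) gb gs.
have h2 := vc l.
have h3 := gb (j (k l).+1).
have h4 : (k l).+1%:R^-1 <= N.+1%:R^-1 :> R.
  by apply: invS_le; apply: leq_trans Nl (increasing_ge kinc l).
have h5 := invS_le _ _ Nl.
set G := g _ in h1 h3 *; set P := phi _ g in h1 *.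
rewrite -/(c (v l)) in h1.
(* row [b l] sees the coordinate [a l] only, with coefficient [c (v l)] near [r] *)
have -> : P - r * G = (P - G * c (v l)) + G * (c (v l) - r) by ring.
apply: le_trans (ler_normD _ _) _; rewrite normrM.
have h6 : `|G| * `|c (v l) - r| <= `|c (v l) - r| by rewrite ler_piMl.
move: h1 h2 h4 h5 h6 hN; set x := `|_ - r|.
set y := (k l).+1%:R^-1; set z := N.+1%:R^-1; set w := l.+1%:R^-1; lra.
Qed.
End functionals.

(** * Bounded functions on a subset and their extensions by zero *)

Section extension.
Context {R : realType}.
Implicit Types A B : set nat.

Lemma ext_in A (f : A -> R) (x : A) : 'valL_0 f (val x) = f x.
Proof. by rewrite ext0E valK. Qed.

Lemma ext_out A (f : A -> R) n : n \notin A -> 'valL_0 f n = 0.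
Proof. by move=> nA; rewrite ext0E insubN. Qed.

Lemma linf_ext A (f g : linf R A) : 'valL_0 f =1 'valL_0 g -> f = g.
Proof.
by move=> fg; apply/val_inj/funext => x /=; rewrite -ext_in fg ext_in.
Qed.

Lemma ext_recut A B (f : linf R A) n :
  'valL_0 (recut A B f) n = if n \in B then 'valL_0 f n else 0.
Proof.
have [nB|nB] := boolP (n \in B); last exact: ext_out.
have -> : n = val (SigSub nB : B) by [].
by rewrite ext_in.
Qed.

Lemma ext_linear A a (f g : linf R A) n :
  'valL_0 (a *: f + g) n = a * 'valL_0 f n + 'valL_0 g n.
Proof. by rewrite !ext0E; case: insub => //=; rewrite mulr0 addr0. Qed.

Lemma extB A (f g : linf R A) n :
  'valL_0 (f - g) n = 'valL_0 f n - 'valL_0 g n.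
Proof. by rewrite !ext0E; case: insub => //=; rewrite subr0. Qed.

Lemma ext_bdd A (f : linf R A) n : `|'valL_0 f n| <= `|f|.
Proof.
by rewrite ext0E; case: insub => [x|] /=; rewrite ?normr0 ?linf_norm_ge.
Qed.

Lemma null_ext A (f : linf R A) :
  (f \in @null_pred R A) <-> ('valL_0 f @ \oo --> (0 : R)).
Proof. by split=> [/asboolP|h]; last exact/asboolP. Qed.

Lemma cls_eq0 A (f : linf R A) : cls f = 0 <-> ('valL_0 f @ \oo --> (0 : R)).
Proof.
rewrite -null_ext -[f in X in _ <-> X]subr0 -cls_eqP.
by rewrite (_ : cls 0 = 0) //; exact: raddf0.
Qed.

Lemma clsZD A a (f g : linf R A) : cls (a *: f + g) = a *: cls f + cls g.
Proof. by rewrite clsD -cls_scale. Qed.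

Lemma recut_linear A B : linear (recut A B : linf R A -> linf R B).
Proof.
move=> a f g; apply: linf_ext => n; rewrite ext_recut !ext_linear !ext_recut.
by case: ifP => //; rewrite mulr0 addr0.
Qed.

Lemma qrecut_linear A B : linear (qrecut A B : linf_c0 R A -> linf_c0 R B).
Proof.
move=> a p q; rewrite -[p]cls_reprK -[q]cls_reprK.
by rewrite -clsZD !qrecutE recut_linear clsZD.
Qed.

Lemma recut_recut A B C (f : linf R A) : A `&` C `<=` B ->
  recut B C (recut A B f) = recut A C f.
Proof.
move=> ACB; apply: linf_ext => n; rewrite !ext_recut.
case: (boolP (n \in C)) => // nC; case: (boolP (n \in B)) => // nB.
rewrite ext_out //; apply/negP => nA; move/negP: nB; apply.
by apply/mem_set/ACB; split; exact: set_mem.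
Qed.

Lemma qrecut_recut A B C (q : linf_c0 R A) : A `&` C `<=` B ->
  qrecut B C (qrecut A B q) = qrecut A C q.
Proof. by move=> h; rewrite -[q]cls_reprK !qrecutE recut_recut. Qed.

Lemma qrecut_id A (q : linf_c0 R A) : qrecut A A q = q.
Proof.
rewrite -[q]cls_reprK qrecutE; congr cls; apply: linf_ext => n.
by rewrite ext_recut; case: (boolP (n \in A)) => // nA; rewrite ext_out.
Qed.

Lemma qrecut_sub_inj A A' : A' `<=` A -> injective (@qrecut R A' A).
Proof.
move=> A'A; apply: (can_inj (g := @qrecut R A A')) => q.
by rewrite qrecut_recut ?qrecut_id // => n [/A'A].
Qed.

Lemma qrecut_cofinite_inj B B' : cofinite_in B' B -> injective (@qrecut R B B').
Proof.
move=> [B'B Bfin]; apply: (can_inj (g := @qrecut R B' B)) => q.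
rewrite -[q]cls_reprK !qrecutE; apply/cls_eqP/null_predP => e e0.
have [s sE] := (finite_seqP _).1 Bfin.
exists (\max_(i <- s) i).+1 => // n ns.
rewrite [X in `|X|]extB !ext_recut.
have [nB'|nB'] := boolP (n \in B').
  by rewrite mem_set ?subrr ?normr0 ?ltW //; apply: B'B; exact: set_mem.
have nB : n \notin B.
  apply/negP => nB; move: ns; rewrite /= leqNgt => /negP; apply.
  rewrite ltnS leq_bigmax_seq //; have : (B `\` B') n.
    by split; [exact: set_mem|move=> /mem_set; exact/negP].
  by rewrite sE.
by rewrite (negbTE nB) sub0r normrN ext_out // normr0 ltW.
Qed.

Lemma identify_localization A B A' B' (T : linf_c0 R setT -> linf_c0 R setT) :
  A' `<=` A -> B' `<=` B ->
  identify A' B' (localization B A T) =1 localization B' A' T.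
Proof.
move=> A'A B'B q; rewrite /identify /localization /= /P_ /I_.
by rewrite !qrecut_recut // => n [] //; [move=> /A'A|move=> _ /B'B].
Qed.

(** The junk value 0 is taken on unbounded [f], so that [restriction A] is linear
    on bounded functions only. *)
Definition restriction A (f : nat -> R) : linf R A :=
  insubd (0 : linf R A) (sigL A f).

Lemma bdd_sigL A (f : nat -> R) : bdd f -> sigL A f \in @bounded_pred R A.
Proof. by move=> [C fC]; apply/bounded_predP; exists C => x; exact: fC. Qed.

Lemma ext_restriction A f n : bdd f ->
  'valL_0 (restriction A f) n = if n \in A then f n else 0.
Proof.
move=> fb; have [nA|nA] := boolP (n \in A); last exact: ext_out.
have -> : n = val (SigSub nA : A) by [].
by rewrite ext_in /= /restriction /= insubdK //; exact: bdd_sigL.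
Qed.

Lemma restriction_linear A a f g : bdd f -> bdd g ->
  restriction A (a *: f + g) = a *: restriction A f + restriction A g.
Proof.
move=> fb gb; apply: linf_ext => n; rewrite ext_linear !ext_restriction //.
  by case: ifP => //; rewrite mulr0 addr0.
case: fb gb => [C fC] [D gD]; exists (`|a| * C + D) => k.
by rewrite (le_trans (ler_normD _ _)) // lerD // normrM ler_wpM2l.
Qed.

Lemma restriction_ball A f : in_ball f -> `|restriction A f| <= 1.
Proof.
move=> fb; apply: linf_norm_le => // x; rewrite -ext_in ext_restriction.
  by rewrite mem_set; [exact: fb|exact: set_valP].
exact: in_ball_bdd.
Qed.

End extension.

(** * Scaled bijections *)

Section scaled_bijections.
Context {R : realType}.
Implicit Types A B : set nat.

(** This form of nullity does not mention the order of the index set, so it is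
    preserved by injective reindexing. *)
Lemma null_finiteP A (f : linf R A) : (f \in @null_pred R A) <->
  forall e, 0 < e -> finite_set [set x : A | e < `|f x|].
Proof.
rewrite null_ext cvg0P; split=> h e /[dup] e0 /h => [[N hN]|fin].
  apply: (sub_finite_set (B := val @^-1` `I_N)).
    move=> x /= fx; rewrite ltnNge; apply/negP => /hN.
    by rewrite ext_in leNgt fx.
  by apply: finite_preimage (finite_II N) => x y _ _; exact: val_inj.
have /finite_seqP[s sE] := finite_image (val : A -> nat) fin.
exists (\max_(i <- s) i).+1 => n sn; rewrite leNgt; apply/negP => fn.
have nA : n \in A.
  by apply: contraTT fn => nA; rewrite ext_out // normr0 -leNgt ltW.
have : n \in s.
  have : [set` s] n by rewrite -sE; exists (SigSub nA) => //=; rewrite -ext_in.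
  by [].
by move/(@leq_bigmax_seq _ _ predT id) => /(_ isT); rewrite leqNgt sn.
Qed.

Lemma operator_continuous (E F : normedModType R) (f : E -> F) :
  operator f -> continuous f.
Proof.
move=> [flin [C fC]].
pose fL := GRing.isLinear.Build R _ _ _ f flin.
pose f' : {linear E -> F} := HB.pack f fL.
apply: (bounded_linear_continuous (f := f')); apply/linear_boundedP.
exists C; split; first exact: num_real.
by move=> M CM x; rewrite (le_trans (fC x)) // ler_wpM2r // ltW.
Qed.

Section one_map.
Variables (A B : set nat) (s : B -> A) (r : R).
Hypothesis sinj : injective s.

Lemma linf_comp_linear : linear (linf_comp s : linf R A -> linf R B).
Proof. by move=> a f g; exact: val_inj. Qed.

Lemma norm_linf_comp (f : linf R A) : `|linf_comp s f| <= `|f|.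
Proof.
by apply: linf_norm_le => [|x]; [exact: normr_ge0|exact: (linf_norm_ge f)].
Qed.

Lemma linf_comp_null (f : linf R A) :
  f \in @null_pred R A -> linf_comp s f \in @null_pred R B.
Proof.
move=> /null_finiteP fn; apply/null_finiteP => e /fn.
by apply: finite_preimage => x y _ _; exact: sinj.
Qed.

Lemma scaled_comp_operator : operator (fun f : linf R A => r *: linf_comp s f).
Proof.
split=> [a f g|]; first by rewrite linf_comp_linear scalerDr !scalerA mulrC.
exists `|r| => f; rewrite normrZ ler_wpM2l //; exact: norm_linf_comp.
Qed.

Variable V : linf_c0 R A -> linf_c0 R B.
Hypothesis VE : forall f, V (cls f) = cls (r *: linf_comp s f).

Lemma scaled_comp_linear : linear V.
Proof.
move=> a p q; rewrite -[p]cls_reprK -[q]cls_reprK -clsZD !VE -clsZD.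
by rewrite scaled_comp_operator.1.
Qed.

Lemma scaled_comp_continuous : continuous V.
Proof.
have Vb q : `|V q| <= `|r| * `|q|.
  apply/ler_addgt0Pr => e e0.
  have r0 : 0 < `|r| + 1 by rewrite ltr_wpDl.
  have [|f <- fq] := @linf_c0_norm_lt R A q (`|q| + e / (`|r| + 1)).
    by rewrite ltrDl divr_gt0.
  rewrite VE; apply: le_trans (linf_c0_norm_le _) _.
  rewrite normrZ.
  apply: le_trans (ler_wpM2l (normr_ge0 r) (norm_linf_comp f)) _.
  apply: le_trans (ler_wpM2l (normr_ge0 r) (ltW fq)) _.
  rewrite mulrDr lerD2l mulrCA ger_pMr // ler_pdivrMr // mul1r lerDl.
  exact: ler01.
by apply: operator_continuous; split; [exact: scaled_comp_linear|exists `|r|].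
Qed.
End one_map.

(** A trivial operator whose cofinite sets are the whole of [A] and [B]. *)
Definition scaled_bijection A B (V : linf_c0 R A -> linf_c0 R B) : Prop :=
  exists (s : B -> A) (r : R), [/\ bijective s, r != 0
    & forall f, V (cls f) = cls (r *: linf_comp s f)].

Section scaled.
Variables (A B : set nat) (V : linf_c0 R A -> linf_c0 R B).
Hypothesis hV : scaled_bijection V.

Lemma scaled_isomorphism : isomorphism V.
Proof.
have [s [r [[t st ts] r0 VE]]] := hV.
have tinj : injective t := can_inj ts.
pose W q := cls (r^-1 *: linf_comp t (cls_repr q)) : linf_c0 R A.
have WE f : W (cls f) = cls (r^-1 *: linf_comp t f).
  apply/cls_eqP; rewrite -scalerBr rpredZ //.
  rewrite -[- linf_comp t f]scaleN1r addrC -linf_comp_linear scaleN1r addrC.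
  by apply: linf_comp_null => //; apply/cls_eqP; rewrite cls_reprK.
split; first exact: scaled_comp_linear VE.
  exact: scaled_comp_continuous VE.
exists W; split; last exact: scaled_comp_continuous WE.
  move=> q; rewrite -[q]cls_reprK VE WE; congr cls; set q' := cls_repr q.
  apply/val_inj/funext => x; rewrite -[LHS]/(r^-1 * (r * q' (s (t x)))).
  by rewrite ts mulKf.
move=> q; rewrite -[q]cls_reprK WE VE; congr cls; set q' := cls_repr q.
apply/val_inj/funext => x; rewrite -[LHS]/(r * (r^-1 * q' (t (s x)))).
by rewrite st mulVKf.
Qed.

Lemma cofinite_in_refl (C : set nat) : cofinite_in C C.
Proof. by split=> //; rewrite setDv. Qed.

Lemma identify_id q : identify A B V q = V q.
Proof. by rewrite /identify /= !qrecut_id. Qed.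

Lemma scaled_trivial : trivial_operator V.
Proof.
have [s [r [sb r0 VE]]] := hV; exists A, B, s, r.
split=> //; [exact: cofinite_in_refl..|] => f.
by rewrite identify_id.
Qed.

Lemma scaled_continuous_lifting : exists A' B' (S : linf R A' -> linf R B'),
  is_lifting V S /\ product_continuous_on_ball S.
Proof.
have [s [r [sb r0 VE]]] := hV.
exists A, B, (fun f => r *: linf_comp s f); split.
  split; [exact: cofinite_in_refl..|exact: scaled_comp_operator|] => f.
  by rewrite identify_id.
apply: continuous_subspaceT; apply: continuous_comp_initial => f.
apply: (proj2 (@pointwise_cvgP _ _ _ _ (fmap_filter _ (nbhs_filter f)))) => x.
(* Each coordinate of the image depends on a single coordinate of [g]. *)
have evf : (fun g : pw_linf R A => g (s x)) @ f --> f (s x).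
  apply: (@continuous_comp _ _ _ (@linf_fun R A : pw_linf R A -> {ptws A -> R})
    (@proj A (fun=> R) (s x))); first exact: initial_continuous.
  exact: (@proj_continuous A (fun=> R)).
exact: (cvgM (cvg_cst r) evf).
Qed.

(** The partial sums are eventually constant. *)
Lemma series_single (u : nat -> R) k : (forall n, n != k -> u n = 0) ->
  series u @ \oo --> u k.
Proof.
move=> uk; apply: cvg_near_cst; exists k.+1 => // n /= kn.
rewrite /series /= (bigD1_seq k) ?iota_uniq ?mem_index_iota //=.
by rewrite big1 ?addr0.
Qed.

Lemma scaled_matrix : matrix_operator V.
Proof.
have [s [r [sb r0 VE]]] := hV.
pose b i j : R := if j == s i then r else 0.
have bE (f : linf R A) : matrix_image b f (r *: linf_comp s f).
  move=> i; set u := 'valL_0 _.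
  have -> : (r *: linf_comp s f) i = u (val (s i)).
    by rewrite /u ext_in /b eqxx.
  apply: series_single => n ni; rewrite /u.
  have [nA|nA] := boolP (n \in A); last exact: ext_out.
  have -> : n = val (SigSub nA : A) by [].
  rewrite ext_in /b; case: eqP => [si|]; last by rewrite mul0r.
  by move: ni; rewrite -si /= eqxx.
have null (f : c0 R A) : r *: linf_comp s f \in @null_pred R B.
  by rewrite rpredZ //; apply: linf_comp_null (valP f); exact: bij_inj.
exists A, B, b; split; [exact: cofinite_in_refl..| |].
  exists (fun f => C0 (null f)); last by move=> f; exact: bE.
  have [lin [C hC]] := scaled_comp_operator s r.
  split; last by exists C => f; exact: hC.
  by move=> a f g; apply: val_inj; exact: lin.
by move=> f; exists (r *: linf_comp s f); rewrite ?identify_id.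
Qed.
End scaled.
End scaled_bijections.

(** * Matrix operators *)

Section matrices.
Context {R : realType} {A B : set nat} (b : B -> A -> R).

Lemma matrix_image_unique f (g h : B -> R) :
  matrix_image b f g -> matrix_image b f h -> g = h.
Proof. by move=> fg fh; apply/funext => i; apply: cvg_unique (fg i) (fh i). Qed.

Lemma matrix_image_linear a (f f' : linf R A) (g g' : linf R B) :
  matrix_image b f g -> matrix_image b f' g' ->
  matrix_image b (a *: f + f') (a *: g + g').
Proof.
move=> fg fg' i; rewrite -[linf_fun (_ + _) i]/(a * g i + g' i).
rewrite (_ : series _ = fun n => a * series ('valL_0 (fun j => b i j * f j)) n
  + series ('valL_0 (fun j => b i j * f' j)) n); last first.
  apply/funext => n; rewrite /series mulr_sumr -big_split.
  apply: eq_bigr => k _; rewrite [LHS]ext0E ext0E ext0E; case: insub => [j|].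
    rewrite -[LHS]/(b i j * (a * f j + f' j)).
    by rewrite -[RHS]/(a * (b i j * f j) + b i j * f' j); ring.
  by rewrite /= mulr0 addr0.
exact: (cvgD (cvgM (cvg_cst a) (fg i)) (fg' i)).
Qed.

(** Truncations are null, so the bound of a matrix on null functions controls the
    partial sums of its rows on bounded ones. *)
Definition truncate n (f : linf R A) : linf R A :=
  recut (`I_n `&` A) A (recut A (`I_n `&` A) f).

Lemma ext_truncate n (f : linf R A) k :
  'valL_0 (truncate n f) k = if (k < n)%N then 'valL_0 f k else 0.
Proof.
rewrite !ext_recut in_setI; have [kA|kA] := boolP (k \in A).
  by rewrite andbT; congr (if _ then _ else _); apply/idP/idP; rewrite inE.
by rewrite ext_out ?if_same.
Qed.

Lemma truncate_null n f : truncate n f \in @null_pred R A.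
Proof.
apply/null_ext/cvg0P => e e0; exists n => k nk.
by rewrite ext_truncate ltnNge nk normr0 ltW.
Qed.

Lemma norm_truncate n f : `|truncate n f| <= `|f|.
Proof.
apply: linf_norm_le => [|x]; first exact: normr_ge0.
by rewrite -ext_in ext_truncate; case: ifP => _; rewrite ?normr0 ?ext_bdd.
Qed.

Lemma matrix_partial_sum (f : linf R A) (g : B -> R) n i :
  matrix_image b (truncate n f) g ->
  g i = series ('valL_0 (fun j => b i j * f j)) n.
Proof.
move=> /(_ i) fg; apply: cvg_unique fg _; first exact: Rhausdorff.
set v := 'valL_0 (fun j => b i j * f j); set u := 'valL_0 _.
have uv k : u k = if (k < n)%N then v k else 0.
  rewrite [u k]ext0E /v [X in if _ then X else _]ext0E.
  case: insubP => [j _ jk|_]; last by rewrite /= if_same.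
  rewrite -[LHS]/(b i j * truncate n f j) -[truncate n f j]ext_in.
  by rewrite ext_truncate jk; case: ifP; rewrite ?mulr0 // -jk ext_in.
apply: cvg_near_cst; exists n => // m nm.
change (\sum_(0 <= k < m) u k = \sum_(0 <= k < n) v k).
rewrite (big_cat_nat (n := n)) //= [X in _ + X]big_nat_cond [X in _ + X]big1.
  rewrite addr0; apply: eq_big_nat => k /andP[_ kn].
  by rewrite uv kn.
by move=> k /andP[/andP[nk _] _]; rewrite uv ltnNge nk.
Qed.
End matrices.

Lemma matrix_liftable (R : realType) (A B : set nat)
  (V : linf_c0 R A -> linf_c0 R B) : matrix_operator V -> liftable V.
Proof.
move=> [A' [B' [b [cA cB [U [_ [M UM]] bU] bV]]]].
have row_sums (f : linf R A') : exists g : linf R B',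
    matrix_image b f g /\ identify A' B' V (cls f) = cls g.
  by have [g ? ?] := bV f; exists g.
have [S SP] := choice row_sums.
exists A', B', S; split=> //; last by move=> f; exact: (SP f).2.
split=> [a f f'|].
  apply/val_inj/(matrix_image_unique (SP _).1).
  by apply: matrix_image_linear; exact: (SP _).1.
exists `|M| => f; apply: linf_norm_le => [|i]; first by rewrite mulr_ge0.
apply: (ler_cvg_to (cvg_norm ((SP f).1 i)) (cvg_cst (`|M| * `|f|))).
apply: nearW => n.
pose fn := C0 (truncate_null n f).
rewrite -(matrix_partial_sum _ (bU fn)).
apply: le_trans (linf_norm_ge (U fn) i) _.
apply: le_trans (UM fn) _.
apply: le_trans (ler_wpM2r (normr_ge0 _) (ler_norm M)) _.
rewrite ler_wpM2l //; exact: norm_truncate.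
Qed.

(** * Extracting a scaled bijection from a liftable isomorphism *)

Section extraction.
Context {R : realType} {A B : set nat}.
Variables (V : linf_c0 R A -> linf_c0 R B) (S : linf R A -> linf R B).
Hypotheses (Vlin : linear V) (Vinj : injective V).
Hypotheses (Sop : operator S) (VS : forall f, V (cls f) = cls (S f)).
Hypothesis Ainf : infinite_set A.

Let row i f := 'valL_0 (S (restriction A f)) i.

(** From left to right this is injectivity of [V]; from right to left, it says
    that [S] maps null functions to null functions because [V] is well defined
    on classes. *)
Lemma lifting_null f : bdd f -> (row ^~ f @ \oo --> (0 : R)) <->
  ('valL_0 (restriction A f) @ \oo --> (0 : R)).
Proof.
move=> fb; rewrite -!cls_eq0 -VS.
have V0 : V 0 = 0.
  by have := Vlin (-1) 0 0; rewrite scaler0 addr0 scaleN1r addNr.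
by split=> [|-> //]; rewrite -{1}V0 => /Vinj.
Qed.

(** The selected rows [b k] and coordinates [a k] are both enumerated by [k], and
    the bijection matches equal indices: [b k |-> a k]. *)
Lemma exists_scaled_bijection : exists A1 B1 : set nat,
  [/\ A1 `<=` A, B1 `<=` B, infinite_set A1, infinite_set B1
    & scaled_bijection (identify A1 B1 V)].
Proof.
have [Slin [C SC]] := Sop.
have rowP i : bounded_functional `|C| (row i).
  split=> [a f g fb gb|f fb].
    by rewrite /row restriction_linear // Slin ext_linear.
  apply: le_trans (ext_bdd _ _) _; apply: le_trans (SC _) _.
  apply: le_trans (ler_wpM2r (normr_ge0 _) (ler_norm C)) _.
  by rewrite ler_piMr // restriction_ball.
have columns j : row ^~ (delta j) @ \oo --> (0 : R).
  have db : bdd (delta j : nat -> R) := in_ball_bdd (in_ball_delta j).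
  apply/(lifting_null db)/cvg0P => e e0; exists j.+1 => n jn.
  rewrite ext_restriction // /delta gtn_eqF //.
  by case: ifP => _; rewrite normr0 ltW.
have inj Y : Y `<=` A -> infinite_set Y -> ~ (row ^~ (chi Y) @ \oo --> (0 : R)).
  move=> YA /infinite_unbounded Yinf.
  have cb : bdd (chi Y : nat -> R) := in_ball_bdd (in_ball_chi Y).
  move=> /(lifting_null cb)/cvg0P/(_ (1 / 2)) h.
  have [|N hN] := h; first by rewrite divr_gt0.
  have [n Yn /hN] := Yinf N.
  rewrite ext_restriction // (mem_set (YA _ Yn)) /chi mem_set // normr1.
  by lra.
have [a [b [r [ainc binc r0 ab conv]]]] :=
  scaled_subsequence rowP columns Ainf inj.
have ainj := increasing_inj ainc; have binj := increasing_inj binc.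
have aA k : A (a k) by have [] := ab k.
(* [row i] is identically zero when [i] is not in [B] *)
have bB k : b k \in B.
  by apply/negPn/negP => bkB; have [_] := ab k; rewrite /row ext_out ?eqxx.
exists (range a), (range b); split.
- by move=> _ [k _ <-].
- by move=> _ [k _ <-]; exact: set_mem.
- exact: infinite_range.
- exact: infinite_range.
have index (u : nat -> nat) (x : range u) : exists k, u k = val x.
  by have [k _ uk] := set_valP x; exists k.
have [ka kaP] := choice (index a); have [kb kbP] := choice (index b).
pose at_ (u : nat -> nat) k : range u := SigSub (mem_set (imageT u k)).
pose s (y : range b) : range a := at_ a (kb y).
pose t (x : range a) : range b := at_ b (ka x).
exists s, r; split=> //.
  exists t => [y|x]; apply: val_inj => /=.
    by rewrite -kbP; congr b; apply: ainj; rewrite kaP.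
  by rewrite -kaP; congr a; apply: binj; rewrite kbP.
move=> f; pose F := 'valL_0 f.
have Fb : bdd F by exists `|f| => n; exact: ext_bdd.
have Fs : supp_in F (range a).
  by move=> n; apply: contra_neqP => na; apply: ext_out; apply/negP => /set_mem.
have -> : identify (range a) (range b) V (cls f) =
    cls (recut B (range b) (S (restriction A F))).
  rewrite /identify /= qrecutE (_ : recut _ _ f = restriction A F).
    by rewrite VS qrecutE.
  by apply: linf_ext => n; rewrite ext_recut ext_restriction.
apply/cls_eqP/null_ext/cvg0P => e e0.
have /cvg0P/(_ _ e0)[N hN] := conv F Fb Fs.
exists (b N) => n bNn.
have [nb|nb] := boolP (n \in range b); last by rewrite ext_out // normr0 ltW.
have [k _ bk] := set_mem nb; rewrite extB ext_recut nb.
have -> : 'valL_0 (r *: linf_comp s f) n = r * F (a k).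
  have -> : n = val (at_ b k) by [].
  rewrite ext_in -[LHS]/(r * f (s (at_ b k))); congr (_ * _).
  have -> : a k = val (s (at_ b k)).
    by rewrite /=; congr a; apply: binj; rewrite kbP.
  by rewrite /F ext_in.
rewrite -bk; apply: hN.
by have := binc N k; rewrite !leEnat bk => <-.
Qed.
End extraction.

Lemma liftable_scaled (R : realType) (A B : set nat)
  (T : linf_c0 R setT -> linf_c0 R setT) :
  infinite_set A -> isomorphism (localization B A T) ->
  liftable (localization B A T) ->
  exists A1 B1 : set nat, [/\ infinite_set A1, infinite_set B1
    & scaled_bijection (localization B1 A1 T)].
Proof.
move=> Ainf [Vlin _ [W [WK _ _]]] [A' [B' [S [cA cB Sop SV]]]].
have A'A := cA.1; have B'B := cB.1.
have VE := identify_localization T A'A B'B.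
have lin : linear (localization B' A' T).
  by move=> a p q; rewrite -!VE /identify /= qrecut_linear Vlin qrecut_linear.
have inj : injective (localization B' A' T).
  move=> p q; rewrite -!VE => /(qrecut_cofinite_inj cB)/(can_inj WK).
  exact: qrecut_sub_inj.
have A'inf : infinite_set A'.
  move=> A'fin; apply: Ainf; rewrite -(setDUK A'A) finite_setU.
  by split=> //; exact: cA.2.
have SE f : localization B' A' T (cls f) = cls (S f) by rewrite -VE.
have [A1 [B1 [A1A B1B A1inf B1inf [s [r [sb r0 sE]]]]]] :=
  exists_scaled_bijection lin inj Sop SE A'inf.
exists A1, B1; split=> //; exists s, r; split=> // f.
by rewrite -sE identify_localization.
Qed.

Lemma trivial_scaled (R : realType) (A B : set nat)
  (T : linf_c0 R setT -> linf_c0 R setT) :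
  infinite_set A -> infinite_set B -> trivial_operator (localization B A T) ->
  exists A1 B1 : set nat, [/\ infinite_set A1, infinite_set B1
    & scaled_bijection (localization B1 A1 T)].
Proof.
move=> Ainf Binf [A' [B' [s [r [[A'A Afin] [B'B Bfin] sb r0 VE]]]]].
have cof (C C' : set nat) : C' `<=` C -> finite_set (C `\` C') ->
    infinite_set C -> infinite_set C'.
  move=> C'C Cfin Cinf C'fin; apply: Cinf.
  by rewrite -(setDUK C'C) finite_setU.
exists A', B'; split; [exact: cof Ainf|exact: cof Binf|].
by exists s, r; split=> // f; rewrite -VE identify_localization.
Qed.

Theorem proposition1p4 (R : realType)
  (T : linf_c0 R [set: nat] -> linf_c0 R [set: nat]) (hT : automorphism T) :
  [<-> exists A B : set nat,
         [/\ infinite_set A, infinite_set B, isomorphism (localization B A T)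
           & liftable (localization B A T)];
       exists A B : set nat,
         [/\ infinite_set A, infinite_set B, isomorphism (localization B A T)
           & matrix_operator (localization B A T)];
       exists A B : set nat,
         [/\ infinite_set A, infinite_set B, isomorphism (localization B A T)
           & exists (A' B' : set nat) (S : linf R A' -> linf R B'),
               is_lifting (localization B A T) S
               /\ product_continuous_on_ball S];
       exists A B : set nat,
         [/\ infinite_set A, infinite_set B & trivial_operator (localization B A T)]].
Proof.
tfae.
- move=> [A [B [Ainf _ iso lift]]].
  have [A1 [B1 [A1inf B1inf sc]]] := liftable_scaled Ainf iso lift.
  exists A1, B1; split=> //; first exact: scaled_isomorphism.
  exact: scaled_matrix.
- move=> [A [B [Ainf _ iso /matrix_liftable lift]]].
  have [A1 [B1 [A1inf B1inf sc]]] := liftable_scaled Ainf iso lift.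
  exists A1, B1; split=> //; first exact: scaled_isomorphism.
  exact: scaled_continuous_lifting.
- move=> [A [B [Ainf _ iso [A' [B' [S [lift _]]]]]]].
  have [|A1 [B1 [A1inf B1inf sc]]] := liftable_scaled Ainf iso.
    by exists A', B', S.
  by exists A1, B1; split=> //; exact: scaled_trivial.
- move=> [A [B [Ainf Binf triv]]].
  have [A1 [B1 [A1inf B1inf sc]]] := trivial_scaled Ainf Binf triv.
  exists A1, B1; split=> //; first exact: scaled_isomorphism.
  have [A' [B' [S [lift _]]]] := scaled_continuous_lifting sc.
  by exists A', B', S.
Qed.
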